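(* Let $N_r\ge N_t\ge 2$, let $\mathbf{H}\in\mathbb{C}^{N_r\times N_t}$ have full column rank, and let $\mathbf{H}=\mathbf{Q}\mathbf{L}$ be its thin QL decomposition. Fix a puncturing order $1\le\nu\le N_t-1$ and partition $$\mathbf{L}=\begin{bmatrix}\mathbf{P}&\mathbf{0}\\ \mathbf{R}&\mathbf{S}\end{bmatrix},$$ with $\mathbf{P}\in\mathbb{C}^{\nu\times\nu}$ and $\mathbf{S}\in\mathbb{C}^{(N_t-\nu)\times(N_t-\nu)}$. Define $$\boldsymbol{\Sigma}=\operatorname{diag}(\mathbf{S}^{-1}\mathbf{S}^{-\dagger})^{-1/2},\qquad \mathbf{W}_{\mathrm p}=\begin{bmatrix}\mathbf{I}_\nu&\mathbf{0}\\ \mathbf{0}&\boldsymbol{\Sigma}\mathbf{S}^{-1}\end{bmatrix},\qquad \mathbf{L}_{\mathrm p}=\mathbf{W}_{\mathrm p}\mathbf{L}.$$ Let $$\mathbf{F}_{\mathrm p}=\tfrac{1}{N_0}\mathbf{Q}\mathbf{W}_{\mathrm p}^\dagger\mathbf{L}_{\mathrm p},\qquad \mathbf{G}_{\mathrm p}=\tfrac{1}{N_0}\mathbf{L}_{\mathrm p}^\dagger\mathbf{L}_{\mathrm p},$$ and define the mismatched detection model $$p_{\mathrm p}(\mathbf{y}|\mathbf{x})=\exp\big(2\,\mathrm{Re}\{\mathbf{y}^\dagger\mathbf{F}_{\mathrm p}\mathbf{x}\}-\mathbf{x}^\dagger\mathbf{G}_{\mathrm p}\mathbf{x}\big)$$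 together with $$p_{\mathrm p}(\mathbf{y})=\int p_{\mathrm p}(\mathbf{y}|\mathbf{x})\,p(\mathbf{x})\,d\mathbf{x}.$$ Assume $\mathbf{x}\sim\mathcal{CN}(\mathbf{0},E_s\mathbf{I}_{N_t})$ with prior density $p(\mathbf{x})$, let $\mathbf{y}=\mathbf{H}\mathbf{x}+\mathbf{z}$ with $\mathbf{z}\sim\mathcal{CN}(\mathbf{0},N_0\mathbf{I}_{N_r})$ independent of $\mathbf{x}$, and set $\beta=E_s/N_0$. Then the lower bound on the achievable information rate of the WLD detector, $$I_{\mathrm{LB}}^{\mathrm{WLD}}=\mathbb{E}_{\mathbf{Y},\mathbf{X}}[\log p_{\mathrm p}(\mathbf{y}|\mathbf{x})]-\mathbb{E}_{\mathbf{Y}}[\log p_{\mathrm p}(\mathbf{y})],$$ in which the expectations are taken with respect to the true joint distribution of $(\mathbf{x},\mathbf{y})$, equals $$I_{\mathrm{LB}}^{\mathrm{WLD}}=\log\det\big(\mathbf{I}+\beta\mathbf{L}_{\mathrm p}^\dagger\mathbf{L}_{\mathrm p}\big)-\mathrm{Tr}\big((\mathbf{I}-\mathbf{W}_{\mathrm p}\mathbf{W}_{\mathrm p}^\dagger)(\mathbf{I}+\beta\mathbf{L}_{\mathrm p}\mathbf{L}_{\mathrm p}^\dagger)^{-1}\big).$$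
   Context: The thin QL decomposition $\mathbf{H}=\mathbf{Q}\mathbf{L}$ means that $\mathbf{Q}\in\mathbb{C}^{N_r\times N_t}$ has orthonormal columns and $\mathbf{L}\in\mathbb{C}^{N_t\times N_t}$ is lower triangular with real positive diagonal entries. For a square matrix $\mathbf{A}$, $\operatorname{diag}(\mathbf{A})$ denotes the diagonal matrix having the same diagonal entries as $\mathbf{A}$. The superscript $\dagger$ denotes conjugate transpose, and $\log$ is the natural logarithm. *)

(* Defs.v *)
From HB Require Import structures.
From mathcomp Require Import all_boot all_order all_algebra.
From mathcomp Require Import all_classical all_reals.
From mathcomp Require Import sequences exp trigo measure lebesgue_measure lebesgue_integral.
From mathcomp Require Import complex.

Set Implicit Arguments.
Unset Strict Implicit.
Unset Printing Implicit Defensive.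

Import Order.TTheory GRing.Theory Num.Theory.
Local Open Scope ring_scope.

Section Defs.
Variable R : realType.
Local Notation C := (R[i]).

Definition hadj m n (A : 'M[C]_(m, n)) : 'M[C]_(n, m) := (map_mx (@conjc R) A)^T.

(** Iterated Lebesgue integral over R^k of F : (nat -> R) -> R
    (coordinates 0..k-1; outermost integral is in coordinate 0). *)
Fixpoint intRk (k : nat) (F : (nat -> R) -> R) : R :=
  match k with
  | 0 => F (fun _ => 0)
  | k'.+1 => Rintegral (@lebesgue_measure R) setT
      (fun t : R => intRk k' (fun v => F (fun j => if j is j'.+1 then v j' else t)))
  end.

Definition intC (n : nat) (f : 'cV[C]_n -> R) : R :=
  intRk (n + n) (fun v => f (\col_(i < n) (Complex (v i) (v (n + i)%N)))).

Definition sqnorm n (v : 'cV[C]_n) : R := complex.Re ((hadj v *m v) 0 0).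

Definition cgauss_pdf (n : nat) (s : R) (v : 'cV[C]_n) : R :=
  (pi * s) ^- n * expR (- sqnorm v / s).

Definition thin_QL nr nt (H Q : 'M[C]_(nr, nt)) (L : 'M[C]_nt) : Prop :=
  [/\ hadj Q *m Q = 1%:M,
      (forall i j : 'I_nt, (i < j)%N -> L i j = 0),
      (forall i : 'I_nt, 0 < L i i) &
      H = Q *m L].

Section Punct.
Variables (nr nu m : nat) (Q : 'M[C]_(nr, nu + m)) (L : 'M[C]_(nu + m)) (N0 : R).

Definition Sblk : 'M[C]_m := drsubmx L.
Definition Sinv : 'M[C]_m := invmx Sblk.
(** Sigma = diag(S^-1 S^-dagger)^(-1/2) (diagonal entries are real positive) *)
Definition Sigma : 'M[C]_m :=
  diag_mx (\row_(i < m) ((Num.sqrt (complex.Re ((Sinv *m hadj Sinv) i i)))^-1)%:C%C).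
Definition Wp : 'M[C]_(nu + m) := block_mx 1%:M 0 0 (Sigma *m Sinv).
Definition Lp : 'M[C]_(nu + m) := Wp *m L.
Definition Fp : 'M[C]_(nr, nu + m) := (N0^-1)%:C%C *: (Q *m hadj Wp *m Lp).
Definition Gp : 'M[C]_(nu + m) := (N0^-1)%:C%C *: (hadj Lp *m Lp).

Definition pp_cond (y : 'cV[C]_nr) (x : 'cV[C]_(nu + m)) : R :=
  expR (2 * complex.Re ((hadj y *m Fp *m x) 0 0) - complex.Re ((hadj x *m Gp *m x) 0 0)).

Definition pp_marg (Es : R) (y : 'cV[C]_nr) : R :=
  intC (fun x => pp_cond y x * cgauss_pdf Es x).
End Punct.

Definition Exy nr nt (H : 'M[C]_(nr, nt)) (Es N0 : R)
  (f : 'cV[C]_nt -> 'cV[C]_nr -> R) : R :=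
  intC (fun x => intC (fun z =>
    cgauss_pdf Es x * cgauss_pdf N0 z * f x (H *m x + z))).

Definition I_LB_WLD nr nu m (H Q : 'M[C]_(nr, nu + m)) (L : 'M[C]_(nu + m)) (Es N0 : R) : R :=
  Exy H Es N0 (fun x y => ln (pp_cond Q L N0 y x))
  - Exy H Es N0 (fun x y => ln (pp_marg Q L N0 Es y)).

End Defs.

(* Main.v *)
Require Import Defs.
From HB Require Import structures.
From mathcomp Require Import all_boot all_order all_algebra.
From mathcomp Require Import all_classical all_reals.
From mathcomp Require Import sequences exp trigo measure lebesgue_measure lebesgue_integral.
From mathcomp Require Import complex.
From mathcomp Require Import all_analysis measurable_realfun ring lra.
Import Order.TTheory GRing.Theory Num.Theory.
Import numFieldNormedType.Exports.
Local Open Scope ring_scope.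

Set Implicit Arguments.
Unset Strict Implicit.
Unset Printing Implicit Defensive.

(** In real coordinates every integral in the rate is an iterated
    one-dimensional Gaussian integral.  The marginal of the mismatched model is
    the exponential of a quadratic form and is integrated one coordinate at a
    time: each Schur complement supplies one factor of the determinant and
    completes one square.  Both expectations are then those of quadratic
    polynomials under isotropic Gaussians, so only traces remain.  They simplify
    by H^+ F_p = G_p, the push-through identity
    P (1 + b P^+ P)^-1 = (1 + b P P^+)^-1 P (with P = L_p), and
    Tr (W_p W_p^+) = N_t, which is exactly what the normalisation Sigma achieves. *)

(** * One-dimensional Gaussian integrals with linear term *)

Section gaussian.
Variable R : realType.
Notation mu := (@lebesgue_measure R).

(** Completing the square: the exponent is [- a * (t - b / a) ^+ 2 + (b ^+ 2 / a + c)], that of a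
    normal law of mean [b / a] and variance [(2 * a)^-1]. *)
Lemma gauss_normal_pdf (a b c t : R) : 0 < a ->
  expR (- a * t ^+ 2 + 2 * b * t + c) =
  Num.sqrt (pi / a) * expR (b ^+ 2 / a + c) *
    normal_pdf (b / a) (Num.sqrt (2 * a)^-1) t.
Proof.
move=> a0; have a2 : 0 < (2 * a)^-1 by rewrite invr_gt0 mulr_gt0.
rewrite normal_pdfE; last by rewrite gt_eqF// sqrtr_gt0.
rewrite /normal_peak /normal_fun sqr_sqrtr ?ltW//.
have -> : (2 * a)^-1 * pi *+ 2 = pi / a :> R.
  by rewrite -mulr_natr invfM; field; rewrite gt_eqF.
rewrite [X in _ = X * _]mulrC -!mulrA (mulrA (Num.sqrt _)) divff ?mul1r -?expRD.
  by congr expR; rewrite -mulr_natr; field; rewrite gt_eqF.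
by rewrite gt_eqF// sqrtr_gt0 divr_gt0// pi_gt0.
Qed.

Lemma integrable_gauss (a b c : R) : 0 < a ->
  mu.-integrable setT (fun t => (expR (- a * t ^+ 2 + 2 * b * t + c))%:E).
Proof.
move=> a0; under eq_fun do rewrite gauss_normal_pdf// EFinM.
by apply: integrableZl => //; exact: integrable_normal_pdf.
Qed.

Lemma Rintegral_gauss (a b c : R) : 0 < a ->
  Rintegral mu setT (fun t => expR (- a * t ^+ 2 + 2 * b * t + c)) =
  Num.sqrt (pi / a) * expR (b ^+ 2 / a + c).
Proof.
move=> a0; under eq_Rintegral do rewrite gauss_normal_pdf//.
rewrite RintegralZl//; last exact: integrable_normal_pdf.
by rewrite /Rintegral integral_normal_pdf mulr1.
Qed.

End gaussian.

(** * Moments of order at most two of a centred Gaussian weight *)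

Section moments.
Variables (R : realType) (s : R).
Hypothesis s0 : 0 < s.
Notation mu := (@lebesgue_measure R).

(** Unnormalised weight of one real coordinate of a circular complex Gaussian of variance [s]; that
    coordinate has variance [s / 2]. *)
Definition gker (t : R) : R := expR (- t ^+ 2 / s).

Lemma gkerN t : gker (- t) = gker t.
Proof. by rewrite /gker sqrrN. Qed.

Lemma gker_ge0 t : 0 <= gker t. Proof. exact: expR_ge0. Qed.

Lemma is_derive_gker (t : R) : is_derive t 1 gker (- (2 * t / s) * gker t).
Proof.
rewrite /gker; apply: is_derive_eq; rewrite /GRing.scale /=.
by ring.
Qed.

Lemma continuous_gker : continuous gker.
Proof.
move=> t; apply: differentiable_continuous; apply/derivable1_diffP.
by have := is_derive_gker t; case.
Qed.

(** The reciprocal of [1 + u <= expR u] at [u = t ^+ 2 / s]. *)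
Lemma gker_bound t : gker t <= s / (s + t ^+ 2).
Proof.
have st : 0 < s + t ^+ 2 by rewrite ltr_pwDl// sqr_ge0.
rewrite /gker mulNr expRN -[leRHS]invrK lef_pV2 ?posrE ?expR_gt0 ?invr_gt0 ?divr_gt0//.
rewrite invf_div mulrDl divff ?gt_eqF//; exact: expR_ge1Dx.
Qed.

(** Supplies the boundary value at infinity for the second moment; [gker_bound] squeezes the
    function below [s / t]. *)
Lemma cvg_id_gker : (t * gker t @[t --> +oo] --> (0:R))%classic.
Proof.
apply: (@squeeze_cvgr _ _ _ _ (cst 0) (fun t => s * t^-1)).
- near=> t.
  have t0 : 0 < t by near: t; exact: nbhs_pinfty_gt.
  apply/andP; split; first by rewrite mulr_ge0 ?gker_ge0// ltW.
  apply: (le_trans (ler_wpM2l (ltW t0) (gker_bound t))).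
  rewrite mulrCA ler_pM2l// ler_pdivrMr ?ltr_pwDl ?sqr_ge0//.
  by rewrite mulrDr expr2 mulrA mulVf ?gt_eqF// mul1r lerDr mulr_ge0 ?invr_ge0 ?ltW.
- exact: cvg_cst.
- rewrite -(mulr0 s); apply: cvgM; first exact: cvg_cst.
  apply/gtr0_cvgV0; last exact: cvg_id.
  by near=> t; near: t; exact: nbhs_pinfty_gt.
Unshelve. all: by end_near. Qed.

Lemma continuous_poly_gker (c0 c1 c2 : R) :
  continuous (fun t => (c0 + c1 * t + c2 * t ^+ 2) * gker t).
Proof.
move=> t; apply: cvgM; last exact: continuous_gker.
apply: cvgD; first apply: cvgD; [exact: cvg_cst| |].
  by apply: cvgM; [exact: cvg_cst|exact: cvg_id].
by apply: cvgM; [exact: cvg_cst|exact: exprn_continuous].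
Qed.

Lemma integrable_gker : mu.-integrable setT (EFin \o gker).
Proof.
have := @integrable_gauss R s^-1 0 0; rewrite invr_gt0 => /(_ s0).
apply: eq_integrable => // t _; congr EFin; rewrite /gker; congr expR.
by rewrite mulr0 mul0r !addr0 mulrC mulNr mulrN.
Qed.

(* [t ^+ 2 / (2 s) <= expR (t ^+ 2 / (2 s))] trades the polynomial factor for a wider Gaussian *)
Lemma integrable_sqr_gker : mu.-integrable setT (EFin \o (fun t => t ^+ 2 * gker t)).
Proof.
have s2 : 0 < (2 * s)^-1 by rewrite invr_gt0 mulr_gt0.
have := integrable_gauss 0 0 s2 => /(integrableZl measurableT (2 * s)).
apply: le_integrable => //.
  apply/measurable_EFinP; apply: continuous_measurable_fun => t.
  by apply: cvgM; [exact: exprn_continuous|exact: continuous_gker].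
move=> t _; rewrite /= lee_fin !ger0_norm; first last.
- by rewrite mulr_ge0 ?gker_ge0 ?sqr_ge0.
- by rewrite mulr_ge0 ?expR_ge0// mulr_ge0// ltW.
rewrite mulr0 mul0r !addr0 /gker.
have -> : - t ^+ 2 / s = - (2 * s)^-1 * t ^+ 2 + - (2 * s)^-1 * t ^+ 2.
  by field; rewrite gt_eqF.
rewrite expRD mulrA ler_wpM2r ?expR_ge0//.
rewrite mulNr expRN ler_pdivrMr ?expR_gt0//.
rewrite -ler_pdivrMl ?mulr_gt0// (le_trans _ (expR_ge1Dx _))//.
by rewrite lerDr.
Qed.

(** Dominated through [|t| <= 1 + t ^+ 2]. *)
Lemma integrable_id_gker : mu.-integrable setT (EFin \o (fun t => t * gker t)).
Proof.
have := integrableD measurableT integrable_gker integrable_sqr_gker.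
apply: le_integrable => //.
  apply/measurable_EFinP; apply: continuous_measurable_fun => t.
  by apply: cvgM; [exact: cvg_id|exact: continuous_gker].
move=> t _; rewrite /= lee_fin normrM (ger0_norm (gker_ge0 t)).
rewrite -[X in _ <= `|X + _|]mul1r -mulrDl normrM (ger0_norm (gker_ge0 t)).
rewrite ler_wpM2r ?gker_ge0// (@ger0_norm _ (1 + _)) ?addr_ge0 ?sqr_ge0//.
by rewrite ler_norml; apply/andP; split; nra.
Qed.

(** The left half line is reflected by a change of variables valid for nonnegative integrands,
    whence the sign hypothesis on [t <= 0]. *)
Lemma Rintegral_halves (h : R -> R) : continuous h ->
  (forall t, t <= 0 -> 0 <= h t) -> mu.-integrable setT (EFin \o h) ->
  Rintegral mu setT h =
  Rintegral mu `[0, +oo[%classic h + Rintegral mu `[0, +oo[%classic (h \o -%R).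
Proof.
move=> ch h0 ih.
have mh D : measurable_fun D h.
  by apply: measurable_funTS; exact: continuous_measurable_fun.
have sU : (@setT R) = (`]-oo, 0] `|` `]0, +oo[)%classic.
  by apply/seteqP; split => // t _ /=; rewrite !in_itv/= andbT; case: (leP t 0); [left|right].
rewrite {1}sU Rintegral_setU//=; last 2 first.
- by rewrite -sU.
- by apply/disj_set2P/seteqP; split => // t []/=; rewrite !in_itv/= andbT leNgt => /negP.
rewrite addrC Rintegral_itv_obnd_cbnd ?(integrableS _ _ _ ih)//; congr (_ + _).
rewrite /Rintegral -[in LHS](@oppr0 R) ge0_integration_by_substitutionNy//.
  exact: continuous_subspaceT.
by move=> t; rewrite in_itv/= oppr0 => /ltW/h0.
Qed.

(** By oddness the two halves cancel. The split is applied to [- t * gker t], which has the sign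
    that [Rintegral_halves] asks for on the left. *)
Lemma Rintegral_id_gker : Rintegral mu setT (fun t => t * gker t) = 0.
Proof.
have iN : mu.-integrable setT (EFin \o (fun t => - t * gker t)).
  have := integrableN integrable_id_gker; apply: eq_integrable => // t _.
  by rewrite /= mulNr.
have cN : continuous (fun t : R => - t * gker t).
  move=> t; apply: cvgM; last exact: continuous_gker.
  by apply: cvgN; exact: cvg_id.
have N0 t : t <= 0 -> 0 <= - t * gker t.
  by move=> t0; rewrite mulr_ge0 ?gker_ge0// oppr_ge0.
have := Rintegral_halves cN N0 iN.
have -> : Rintegral mu setT (fun t => - t * gker t) = - Rintegral mu setT (fun t => t * gker t).
  rewrite -mulN1r -RintegralZl//; last exact: integrable_id_gker.
  by apply: eq_Rintegral => t _; rewrite mulN1r mulNr.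
have -> : Rintegral mu `[0, +oo[%classic (fun t => - t * gker t) =
          - Rintegral mu `[0, +oo[%classic (fun t => t * gker t).
  rewrite -mulN1r -RintegralZl//; last by apply: integrableS integrable_id_gker.
  by apply: eq_Rintegral => t _; rewrite mulN1r mulNr.
have -> : Rintegral mu `[0, +oo[%classic ((fun t => - t * gker t) \o -%R) =
          Rintegral mu `[0, +oo[%classic (fun t => t * gker t).
  by apply: eq_Rintegral => t _; rewrite /= opprK gkerN.
by rewrite addNr => /eqP; rewrite oppr_eq0 => /eqP.
Qed.

(* [(t ^+ 2 - s / 2) * gker t] is the derivative of [- (s / 2) * t * gker t], and it has a constant sign beyond [Num.sqrt s] *)
Lemma Rintegral_sqr_gker : Rintegral mu setT (fun t => t ^+ 2 * gker t) =
  s / 2 * Rintegral mu setT gker.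
Proof.
(* Padded with [0 * t] and [1 * t ^+ 2] to match [continuous_poly_gker]. *)
pose f t := (- (s / 2) + 0 * t + 1 * t ^+ 2) * gker t.
pose F t := - (s / 2) * (t * gker t).
pose c := Num.sqrt s.
have c0 : 0 < c by rewrite sqrtr_gt0.
have c2 : c ^+ 2 = s by rewrite sqr_sqrtr// ltW.
have dF (t : R) : is_derive t 1 F (f t).
  have dg := is_derive_gker t.
  rewrite /F; apply: is_derive_eq; rewrite /GRing.scale /= /f.
  by field; rewrite gt_eqF.
have cF : continuous F.
  move=> t; apply: differentiable_continuous; apply/derivable1_diffP.
  by have := dF t; case.
have cf : continuous f by exact: continuous_poly_gker.
have F'f t : F^`()%classic t = f t.
  by rewrite derive1E; exact: derive_val.
have fE : f = (fun t => t ^+ 2 * gker t - s / 2 * gker t).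
  by apply/funext => t; rewrite /f; ring.
have ig : mu.-integrable setT (EFin \o (fun t => s / 2 * gker t)).
  by have := integrableZl measurableT (s / 2) integrable_gker.
have if' : mu.-integrable setT (EFin \o f).
  have := integrableB measurableT integrable_sqr_gker ig.
  by apply: eq_integrable => // t _; rewrite /= fE.
(* [f] changes sign on [[0, c]], so this bounded piece is treated apart from the tail, where
   nonnegativity justifies the improper integral. The two values telescope to [- F 0 = 0]. *)
have I1 : Rintegral mu `[0, c]%classic f = F c - F 0.
  rewrite /Rintegral (@continuous_FTC2 _ _ F)//.
  - exact: continuous_subspaceT.
  - split=> [t _| |]; [by case: (dF t)| |].
    + exact/cvg_at_right_filter/cF.
    + exact/cvg_at_left_filter/cF.
have I2 : Rintegral mu `[c, +oo[%classic f = 0 - F c.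
  apply: Rintegral_ge0_continuous_FTC2y => //.
  - move=> t ct; rewrite mulr_ge0 ?gker_ge0// mul0r addr0 mul1r addrC subr_ge0.
    rewrite (@le_trans _ _ s)//; first by rewrite ler_pdivrMr// ler_peMr// ?ler1n// ltW.
    by rewrite -c2 ler_pXn2r// nnegrE; [exact: ltW|exact: le_trans (ltW c0) ct].
  - exact: continuous_subspaceT.
  - rewrite -(mulr0 (- (s / 2))); apply: cvgM; first exact: cvg_cst.
    exact: cvg_id_gker.
  - exact/cvg_at_right_filter/cF.
have I3 : Rintegral mu `[0, +oo[%classic f = 0.
  have sU : (`[0, +oo[ = `[0, c] `|` `]c, +oo[)%classic.
    by rewrite -itv_bndbnd_setU// bnd_simp ltW.
  rewrite sU Rintegral_setU//=; last 2 first.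
    by rewrite -sU; apply: integrableS if'.
  - apply/disj_set2P/seteqP; split => // t []/=; rewrite !in_itv/= andbT.
    by move=> /andP[_]; rewrite leNgt => /negP.
  rewrite Rintegral_itv_obnd_cbnd; last by apply: integrableS if'.
  by rewrite I1 I2 /F mul0r mulr0; ring.
have I4 : Rintegral mu `[0, +oo[%classic (fun t => t ^+ 2 * gker t) =
          s / 2 * Rintegral mu `[0, +oo[%classic gker.
  apply/eqP; rewrite -subr_eq0 -RintegralZl//; last by apply: integrableS integrable_gker.
  rewrite -RintegralB// -?fE ?I3//; [by apply: integrableS integrable_sqr_gker|].
  by apply: integrableS ig.
(* Both integrands are even, so the half-line identity [I4] counts twice. *)
rewrite (@Rintegral_halves gker)//; last 3 first.
- exact: continuous_gker.
- by move=> t _; exact: gker_ge0.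
- exact: integrable_gker.
rewrite (@Rintegral_halves (fun t => t ^+ 2 * gker t))//; last 3 first.
- by move=> t; apply: cvgM; [exact: exprn_continuous|exact: continuous_gker].
- by move=> t _; rewrite mulr_ge0 ?gker_ge0 ?sqr_ge0.
- exact: integrable_sqr_gker.
have -> : gker \o -%R = gker by apply/funext => t; exact: gkerN.
have -> : (fun t => t ^+ 2 * gker t) \o -%R = (fun t => t ^+ 2 * gker t).
  by apply/funext => t /=; rewrite gkerN sqrrN.
by rewrite I4 mulrDr.
Qed.

Lemma Rintegral_gker : Rintegral mu setT gker = Num.sqrt (pi * s).
Proof.
have := @Rintegral_gauss R s^-1 0 0; rewrite invr_gt0 => /(_ s0).
rewrite expr2 !mul0r addr0 expR0 mulr1 invrK => <-.
apply: eq_Rintegral => t _; rewrite /gker; congr expR.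
by rewrite mulr0 mul0r !addr0 mulrC mulNr mulrN.
Qed.

Lemma Rintegral_poly_gker (c0 c1 c2 : R) :
  Rintegral mu setT (fun t => (c0 + c1 * t + c2 * t ^+ 2) * gker t) =
  Num.sqrt (pi * s) * (c0 + c2 * (s / 2)).
Proof.
have i0 : mu.-integrable setT (EFin \o (fun t => c0 * gker t)).
  by have := integrableZl measurableT c0 integrable_gker.
have i1 : mu.-integrable setT (EFin \o (fun t => c1 * (t * gker t))).
  by have := integrableZl measurableT c1 integrable_id_gker.
have i2 : mu.-integrable setT (EFin \o (fun t => c2 * (t ^+ 2 * gker t))).
  by have := integrableZl measurableT c2 integrable_sqr_gker.
transitivity (Rintegral mu setT
    (fun t => c0 * gker t + c1 * (t * gker t) + c2 * (t ^+ 2 * gker t))).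
  by apply: eq_Rintegral => t _; ring.
rewrite RintegralD//; last by have := integrableD measurableT i0 i1.
rewrite RintegralD// !RintegralZl ?Rintegral_id_gker ?Rintegral_sqr_gker ?Rintegral_gker//.
- by rewrite mulr0 addr0; ring.
- exact: integrable_sqr_gker.
- exact: integrable_id_gker.
- exact: integrable_gker.
Qed.

End moments.

(** * Entrywise rules that keep matrix products folded *)

Section entries.
Variables (R : pzRingType) (m n : nat).
Implicit Types A B : 'M[R]_(m, n).

Lemma addmxE A B i j : (A + B) i j = A i j + B i j. Proof. exact: mxE. Qed.

Lemma oppmxE A i j : (- A) i j = - A i j. Proof. exact: mxE. Qed.

Lemma scalemxE c A i j : (c *: A) i j = c * A i j. Proof. exact: mxE. Qed.

Lemma trmxE A i j : A^T i j = A j i. Proof. exact: mxE. Qed.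

End entries.

(** * Elimination of the first coordinate by a Schur complement *)

Section schur.
Variables (F : fieldType) (k : nat).
Implicit Type M : 'M[F]_(1 + k).

Definition schur M : F :=
  ulsubmx M 0 0 - (ursubmx M *m invmx (drsubmx M) *m dlsubmx M) 0 0.

(** The vector with first entry 1 that [M] sends to a multiple of the first basis vector when
    [drsubmx M] is invertible; the form of [M] takes the value [schur M] there. *)
Definition schur_vec M : 'cV[F]_(1 + k) :=
  col_mx 1%:M (- (invmx (drsubmx M) *m dlsubmx M)).

Lemma schur_vec_neq0 M : schur_vec M != 0.
Proof. by rewrite col_mx_eq0 negb_and oner_eq0. Qed.

Lemma mul_schur_vec M : drsubmx M \in unitmx ->
  M *m schur_vec M = col_mx (schur M)%:M 0.
Proof.
move=> uM; rewrite /schur_vec -{1}[M]submxK mul_block_col !mulmx1 !mulmxN mulKVmx// subrr.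
by congr col_mx; rewrite [LHS]mx11_scalar addmxE oppmxE mulmxA.
Qed.

Lemma det_schur M : drsubmx M \in unitmx ->
  \det M = schur M * \det (drsubmx M).
Proof.
move=> uM.
(* Block factorisation: the upper triangular factor has determinant [schur M], the lower triangular
   one that of [drsubmx M]. *)
have ME : M = block_mx (schur M)%:M (ursubmx M *m invmx (drsubmx M)) 0 1%:M *m
              block_mx 1%:M 0 (dlsubmx M) (drsubmx M).
  rewrite mulmx_block !mul0mx !mul1mx !mulmx0 mulmx1 !add0r mulmxKV// -[LHS]submxK.
  congr block_mx; rewrite [LHS]mx11_scalar [X in _ + X]mx11_scalar -raddfD/=.
  by rewrite /schur subrK.
by rewrite {1}ME det_mulmx det_ublock det_lblock !det1 det_scalar1 mulr1 mul1r.
Qed.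

End schur.

(** * Iterated real integrals of Gaussians and of quadratic polynomials *)

Section iterated.
Variable R : realType.
Implicit Types (s c t : R) (v : nat -> R).

Lemma eq_intRk k (F G : (nat -> R) -> R) : F =1 G -> intRk k F = intRk k G.
Proof. by move=> /funext ->. Qed.

(** The stream built in the recursive step of [intRk], named so that [intRkS] holds by
    computation. *)
Definition scons t v : nat -> R := fun j => if j is j'.+1 then v j' else t.

Lemma intRkS k (F : (nat -> R) -> R) :
  intRk k.+1 F = Rintegral (@lebesgue_measure R) setT (fun t => intRk k (F \o scons t)).
Proof. by []. Qed.

Definition vcol k v : 'cV[R]_k := \col_(i < k) v i.

Lemma vcolS k t v : vcol (1 + k) (scons t v) = col_mx t%:M (vcol k v).
Proof.
apply/matrixP => i j; rewrite !mxE; by case: splitP => i' ->; rewrite mxE ?ord1.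
Qed.

(** Separates the outermost variable [t] from the others. As [B] may fail to be symmetric, the cross
    term gathers both off-diagonal blocks. *)
Lemma qform_col_mx k t (x : 'cV[R]_k) (B : 'M[R]_(1 + k)) :
  ((col_mx t%:M x)^T *m B *m col_mx t%:M x) 0 0 =
  ulsubmx B 0 0 * t ^+ 2 +
  t * ((ursubmx B + (dlsubmx B)^T) *m x) 0 0 + (x^T *m drsubmx B *m x) 0 0.
Proof.
rewrite -{1}[B]submxK tr_col_mx mul_row_block mul_row_col !mulmxDl !addmxE.
rewrite tr_scalar_mx !mul_scalar_mx -!scalemxAl !mul_mx_scalar.
have -> : (x^T *m dlsubmx B) = ((dlsubmx B)^T *m x)^T by rewrite trmx_mul trmxK.
rewrite !(scalemxE, trmxE); ring.
Qed.

Lemma lform_col_mx k t (x : 'cV[R]_k) (a : 'rV[R]_(1 + k)) :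
  (a *m col_mx t%:M x) 0 0 = lsubmx a 0 0 * t + (rsubmx a *m x) 0 0.
Proof. by rewrite -{1}[a]hsubmxK mul_row_col addmxE mul_mx_scalar scalemxE mulrC. Qed.

(** Odd moments vanish, so only [c] and the diagonal of [B] survive, with second moment [s / 2] per
    coordinate. In the induction the inner integral is again a quadratic polynomial in the outer
    variable. *)
Lemma intRk_poly_gker s k c (a : 'rV[R]_k) (B : 'M[R]_k) : 0 < s ->
  intRk k (fun v => (\prod_(i < k) gker s (v i)) *
    (c + (a *m vcol k v) 0 0 + ((vcol k v)^T *m B *m vcol k v) 0 0)) =
  Num.sqrt (pi * s) ^+ k * (c + s / 2 * \tr B).
Proof.
move=> s0; elim: k c a B => [|k IH] c a B.
  by rewrite /= big_ord0 /mxtrace big_ord0 !mxE !big_ord0; ring.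
(* [k.+1] and [1 + k] are convertible; the second type exposes the blocks. *)
rewrite intRkS; pose a1 : 'rV[R]_(1 + k) := a; pose B1 : 'M[R]_(1 + k) := B.
transitivity (Rintegral (@lebesgue_measure R) setT (fun t =>
  (Num.sqrt (pi * s) ^+ k * (c + s / 2 * \tr (drsubmx B1))
   + (Num.sqrt (pi * s) ^+ k * (lsubmx a1 0 0)) * t
   + (Num.sqrt (pi * s) ^+ k * ulsubmx B1 0 0) * t ^+ 2) * gker s t)).
  apply: eq_Rintegral => t _.
  (* For fixed [t] its weight and its monomials are absorbed into the coefficients, over which the
     induction hypothesis is general. *)
  pose c' := gker s t * (c + lsubmx a1 0 0 * t +
                         ulsubmx B1 0 0 * t ^+ 2).
  pose a' := gker s t *: (rsubmx a1 + t *: (ursubmx B1 +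
                         (dlsubmx B1)^T)).
  rewrite (@eq_intRk _ _ (fun v => (\prod_(i < k) gker s (v i)) *
    (c' + (a' *m vcol k v) 0 0 + ((vcol k v)^T *m (gker s t *: drsubmx B1)
       *m vcol k v) 0 0))).
    by rewrite IH linearZ/= /c'; ring.
  move=> v; rewrite /= big_ord_recl /= (vcolS k t v) (qform_col_mx t (vcol k v) B1).
  rewrite (lform_col_mx t (vcol k v) a1) -[\prod_(i < k) _]/(\prod_(i < k) gker s (v i)).
  rewrite /c' /a' -?scalemxAr -?scalemxAl !mulmxDl -?scalemxAl mulmxDl.
  rewrite !(scalemxE, addmxE); ring.
rewrite Rintegral_poly_gker// exprS.
have -> : \tr B = ulsubmx B1 0 0 + \tr (drsubmx B1).
  rewrite -[\tr B]/(\tr B1) -{1}[B1]submxK mxtrace_block.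
  by rewrite [X in X + _]/mxtrace big_ord_recl big_ord0 addr0.
ring.
Qed.

Definition posdef k (M : 'M[R]_k) :=
  forall x : 'cV[R]_k, x != 0 -> 0 < (x^T *m M *m x) 0 0.

Lemma posdef_unit k (M : 'M[R]_k) : posdef M -> M \in unitmx.
Proof.
move=> pM; rewrite unitmxE unitfE; apply/negP => /det0P[v v0 vM].
by have := pM v^T; rewrite trmxK vM mul0mx mxE ltxx trmx_eq0 => /(_ v0).
Qed.

Lemma posdef_drsubmx k (M : 'M[R]_(1 + k)) : posdef M -> posdef (drsubmx M).
Proof.
move=> pM x x0; have := pM (col_mx 0%:M x); rewrite qform_col_mx expr0n mulr0 mul0r !add0r.
by apply; rewrite col_mx_eq0 negb_and x0 orbT.
Qed.

(** It is the value of the form at the nonzero vector [schur_vec M]. *)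
Lemma posdef_schur_gt0 k (M : 'M[R]_(1 + k)) : posdef M -> 0 < schur M.
Proof.
move=> pM; have := pM _ (schur_vec_neq0 M).
rewrite -mulmxA mul_schur_vec ?posdef_unit//; last exact: posdef_drsubmx.
by rewrite tr_col_mx mul_row_col mulmx0 addr0 trmx1 mul1mx mxE mulr1n.
Qed.

Lemma posdef_det_gt0 k (M : 'M[R]_k) : posdef M -> 0 < \det M.
Proof.
elim: k M => [|k IH] M pM; first by rewrite det_mx00.
pose M1 : 'M[R]_(1 + k) := M.
rewrite -[M]/M1 det_schur ?posdef_unit//; last exact: posdef_drsubmx.
by rewrite mulr_gt0 ?posdef_schur_gt0// IH//; exact: posdef_drsubmx.
Qed.

(* [u] is [b *m invmx M] *)
Lemma intRk_gauss k (M : 'M[R]_k) (b u : 'rV[R]_k) c :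
  M^T = M -> posdef M -> u *m M = b ->
  intRk k (fun v => expR (- ((vcol k v)^T *m M *m vcol k v) 0 0 +
                          2 * (b *m vcol k v) 0 0 + c)) =
  Num.sqrt (pi ^+ k / \det M) * expR ((u *m b^T) 0 0 + c).
Proof.
elim: k M b u c => [|k IH] M b u c sM pM uMb.
  rewrite /= det_mx00 divr1 expr0 sqrtr1 mul1r; congr expR.
  by rewrite !mxE !big_ord0; ring.
rewrite intRkS; pose M1 : 'M[R]_(1 + k) := M; pose b1 : 'rV[R]_(1 + k) := b.
pose u1 : 'rV[R]_(1 + k) := u.
have sM1 : M1^T = M1 by [].
have pM1 : posdef M1 by [].
have pD := posdef_drsubmx pM1.
have uD := posdef_unit pD.
have dl : dlsubmx M1 = (ursubmx M1)^T by rewrite trmx_ursub sM1.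
have sdr : (drsubmx M1)^T = drsubmx M1 by rewrite trmx_drsub sM1.
have al := posdef_schur_gt0 pM1.
pose D := invmx (drsubmx M1).
have Db : (rsubmx b1 *m D *m (ursubmx M1)^T) 0 0 = (ursubmx M1 *m D *m (rsubmx b1)^T) 0 0.
  by rewrite -[LHS]trmxE !trmx_mul trmxK trmx_inv sdr mulmxA.
pose be := (rsubmx b1 *m D *m (ursubmx M1)^T) 0 0.
pose ga := (rsubmx b1 *m D *m (rsubmx b1)^T) 0 0.
transitivity (Rintegral (@lebesgue_measure R) setT (fun t =>
  Num.sqrt (pi ^+ k / \det (drsubmx M1)) *
  expR (- schur M1 * t ^+ 2 + 2 * (lsubmx b1 0 0 - be) * t + (ga + c)))).
  apply: eq_Rintegral => t _.
  (* For fixed [t] the cross terms are linear in the remaining coordinates and shift [b]; by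
     symmetry of [M] the two blocks merge into one. *)
  pose b' := rsubmx b1 - t *: ursubmx M1.
  rewrite (@eq_intRk _ _ (fun v => expR (- ((vcol k v)^T *m drsubmx M1 *m vcol k v) 0 0 +
     2 * (b' *m vcol k v) 0 0 +
     (c - ulsubmx M1 0 0 * t ^+ 2 + 2 * lsubmx b1 0 0 * t)))).
    rewrite (IH _ _ (b' *m D))//; last by rewrite mulmxKV.
    congr (_ * expR _).
    have -> : (b' *m D *m b'^T) 0 0 =
        ga - t * be *+ 2 + t ^+ 2 * (ursubmx M1 *m D *m (ursubmx M1)^T) 0 0.
      rewrite /b' [(_ - _)^T]linearB/= [(_ *: _)^T]linearZ/= !mulmxBl !mulmxBr -!scalemxAl -!scalemxAr.
      rewrite !(addmxE, oppmxE, scalemxE) -Db -/be -/ga; ring.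
    by rewrite /schur dl -/D; ring.
  move=> v; rewrite /= (vcolS k t v) (qform_col_mx t (vcol k v) M1).
  rewrite (lform_col_mx t (vcol k v) b1) dl trmxK; congr expR.
  rewrite /b' mulmxBl -scalemxAl mulmxDl !(addmxE, oppmxE, scalemxE); ring.
rewrite RintegralZl//; last exact: integrable_gauss.
rewrite Rintegral_gauss// -[\det M]/(\det M1) det_schur//.
rewrite mulrA; congr (_ * expR _).
  rewrite -sqrtrM ?divr_ge0 ?exprn_ge0 ?pi_ge0 ?ltW ?posdef_det_gt0//.
  congr Num.sqrt; rewrite exprS; field.
  by rewrite !gt_eqF// posdef_det_gt0.
(* Block elimination in [u1 *m M1 = b1]: the first entry [w] solves
   [w * schur M1 = lsubmx b1 0 0 - be], which identifies the completed squares with [u *m b^T]. *)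
have ub : u1 *m M1 = b1 by [].
pose w := lsubmx u1 0 0.
have u1E : u1 = row_mx w%:M (rsubmx u1) by rewrite /w -mx11_scalar hsubmxK.
have M1E : M1 = block_mx (ulsubmx M1) (ursubmx M1) (ursubmx M1)^T (drsubmx M1).
  by rewrite -dl submxK.
have ur : rsubmx u1 = (rsubmx b1 - w *: ursubmx M1) *m D.
  apply: (can_inj (mulmxK uD)); rewrite mulmxKV//.
  rewrite -ub [in RHS]u1E [X in _ = rsubmx (_ *m X) - _]M1E mul_row_block row_mxKr.
  by rewrite mul_scalar_mx addrC addKr.
have ul : w * schur M1 = lsubmx b1 0 0 - be.
  rewrite -ub [in RHS]u1E [X in _ = (lsubmx (_ *m X)) 0 0 - _]M1E mul_row_block row_mxKl.
  rewrite ur mul_scalar_mx !mulmxBl -!scalemxAl !(addmxE, oppmxE, scalemxE).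
  by rewrite -/be /schur dl -/D; ring.
have b1E : b1^T = col_mx (lsubmx b1)^T (rsubmx b1)^T by rewrite -tr_row_mx hsubmxK.
have -> : u *m b^T = u1 *m b1^T by [].
rewrite [X in (X *m _) 0 0]u1E ur b1E mul_row_col mul_scalar_mx.
rewrite !mulmxBl -!scalemxAl !(addmxE, oppmxE, scalemxE, trmxE) -/ga -Db -/be.
have -> : (lsubmx b1 0 0 - be) ^+ 2 / schur M1 = w * (lsubmx b1 0 0 - be).
  by rewrite -ul; field; rewrite gt_eqF.
ring.
Qed.

End iterated.

(** * Real coordinates for complex vectors and matrices *)

Section realification.
Variable R : realType.
Local Notation C := R[i].
Local Notation Re := (@complex.Re R).
Local Notation Im := (@complex.Im R).

Lemma ReD (x y : C) : Re (x + y) = Re x + Re y. Proof. by case: x y => ? ? []. Qed.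
Lemma ImD (x y : C) : Im (x + y) = Im x + Im y. Proof. by case: x y => ? ? []. Qed.
Lemma ReN (x : C) : Re (- x) = - Re x. Proof. by case: x. Qed.
Lemma ReM (x y : C) : Re (x * y) = Re x * Re y - Im x * Im y.
Proof. by case: x y => ? ? []. Qed.
Lemma ImM (x y : C) : Im (x * y) = Re x * Im y + Im x * Re y.
Proof. by case: x y => ? ? []. Qed.
Lemma ReJ (x : C) : Re (conjc x) = Re x. Proof. by case: x. Qed.
Lemma ImJ (x : C) : Im (conjc x) = - Im x. Proof. by case: x. Qed.
Lemma ReZ (a : R) (x : C) : Re (a%:C%C * x) = a * Re x.
Proof. by case: x => u v; rewrite /= mul0r subr0. Qed.

Definition remx m n (A : 'M[C]_(m, n)) : 'M[R]_(m, n) := map_mx Re A.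
Definition immx m n (A : 'M[C]_(m, n)) : 'M[R]_(m, n) := map_mx Im A.

Lemma Re_sum I (r : seq I) (P : pred I) (F : I -> C) :
  Re (\sum_(i <- r | P i) F i) = \sum_(i <- r | P i) Re (F i).
Proof. exact: (big_morph _ ReD). Qed.

Lemma Im_sum I (r : seq I) (P : pred I) (F : I -> C) :
  Im (\sum_(i <- r | P i) F i) = \sum_(i <- r | P i) Im (F i).
Proof. exact: (big_morph _ ImD). Qed.

Lemma remxM m n p (A : 'M[C]_(m, n)) (B : 'M[C]_(n, p)) :
  remx (A *m B) = remx A *m remx B - immx A *m immx B.
Proof.
apply/matrixP => i j; rewrite !mxE Re_sum -sumrB.
by apply: eq_bigr => k _; rewrite !mxE ReM.
Qed.

Lemma immxM m n p (A : 'M[C]_(m, n)) (B : 'M[C]_(n, p)) :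
  immx (A *m B) = remx A *m immx B + immx A *m remx B.
Proof.
apply/matrixP => i j; rewrite !mxE Im_sum -big_split.
by apply: eq_bigr => k _; rewrite !mxE ImM.
Qed.

Lemma remx_hadj m n (A : 'M[C]_(m, n)) : remx (hadj A) = (remx A)^T.
Proof. by apply/matrixP => i j; rewrite !mxE ReJ. Qed.

Lemma immx_hadj m n (A : 'M[C]_(m, n)) : immx (hadj A) = - (immx A)^T.
Proof. by apply/matrixP => i j; rewrite !mxE ImJ. Qed.

Lemma hadjM m n p (A : 'M[C]_(m, n)) (B : 'M[C]_(n, p)) :
  hadj (A *m B) = hadj B *m hadj A.
Proof. by rewrite /hadj map_mxM trmx_mul. Qed.

Lemma hadjD m n (A B : 'M[C]_(m, n)) : hadj (A + B) = hadj A + hadj B.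
Proof. by apply/matrixP => i j; rewrite !mxE rmorphD. Qed.

Lemma hadjZ m n (a : R) (A : 'M[C]_(m, n)) : hadj (a%:C%C *: A) = a%:C%C *: hadj A.
Proof. by apply/matrixP => i j; rewrite !mxE rmorphM; congr (_ * _); exact: conjc_real. Qed.

Lemma hadjK m n (A : 'M[C]_(m, n)) : hadj (hadj A) = A.
Proof. by apply/matrixP => i j; rewrite !mxE conjcK. Qed.

Lemma hadj1 n : hadj 1%:M = 1%:M :> 'M[C]_n.
Proof. by rewrite /hadj map_mx1 trmx1. Qed.

Lemma hadj_col_mx m1 m2 n (A : 'M[C]_(m1, n)) (B : 'M[C]_(m2, n)) :
  hadj (col_mx A B) = row_mx (hadj A) (hadj B).
Proof. by rewrite /hadj map_col_mx tr_col_mx. Qed.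

Definition realmx m n (A : 'M[C]_(m, n)) : 'M[R]_(m + m, n + n) :=
  block_mx (remx A) (- immx A) (immx A) (remx A).
Definition realcol n (z : 'cV[C]_n) : 'cV[R]_(n + n) := col_mx (remx z) (immx z).
(** The sign makes the product with [realcol z] the real part of [l *m z]. *)
Definition realrow n (l : 'rV[C]_n) : 'rV[R]_(n + n) := row_mx (remx l) (- immx l).

Lemma Re_lform n (l : 'rV[C]_n) (z : 'cV[C]_n) :
  Re ((l *m z) 0 0) = (realrow l *m realcol z) 0 0.
Proof.
rewrite mul_row_col mulNmx -remxM; exact/esym/mxE.
Qed.

Lemma realrowM n (l : 'rV[C]_n) (B : 'M[C]_n) :
  realrow (l *m B) = realrow l *m realmx B.
Proof.
rewrite mul_row_block mulNmx -remxM; congr row_mx.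
by rewrite immxM mulmxN mulNmx opprD.
Qed.

Lemma tr_realcol n (z : 'cV[C]_n) : (realcol z)^T = realrow (hadj z).
Proof. by rewrite tr_col_mx /realrow remx_hadj immx_hadj opprK. Qed.

Lemma tr_realrow n (l : 'rV[C]_n) : (realrow l)^T = realcol (hadj l).
Proof. by rewrite tr_row_mx /realcol remx_hadj immx_hadj linearN. Qed.

Lemma tr_realmx n (B : 'M[C]_n) : (realmx B)^T = realmx (hadj B).
Proof.
by rewrite tr_block_mx /realmx remx_hadj immx_hadj linearN/= opprK.
Qed.

Lemma Re_qform n (B : 'M[C]_n) (z : 'cV[C]_n) :
  Re ((hadj z *m B *m z) 0 0) = ((realcol z)^T *m realmx B *m realcol z) 0 0.
Proof. by rewrite Re_lform realrowM tr_realcol. Qed.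

Lemma mxtrace_realmx n (B : 'M[C]_n) : \tr (realmx B) = 2 * Re (\tr B).
Proof.
rewrite mxtrace_block /mxtrace Re_sum.
under eq_bigr do rewrite mxE.
by rewrite mulr2n mulrDl mul1r.
Qed.

(** Over [C], conjugating by a unipotent block matrix with off-diagonal block ['i] makes the
    embedding block triangular, with [B] and its conjugate on the diagonal. *)
Lemma det_realmx n (B : 'M[C]_n) :
  (\det (realmx B))%:C%C = \det B * conjc (\det B).
Proof.
pose X : 'M[C]_n := map_mx (real_complex R) (remx B).
pose Y : 'M[C]_n := map_mx (real_complex R) (immx B).
have BE : B = X + 'i%C *: Y.
  by apply/matrixP => i j; rewrite !mxE [LHS]complexE.
have BJ : map_mx (@conjc R) B = X - 'i%C *: Y.
  apply/matrixP => i j; rewrite !mxE; case: (B i j) => u v.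
  by rewrite [LHS]complexE/= rmorphN mulrN.
rewrite -[conjc _]det_map_mx -[LHS]det_map_mx map_block_mx map_mxN -/X -/Y.
transitivity (\det (block_mx 1%:M ('i%C%:M) 0 1%:M *m block_mx X (- Y) Y X *m
                    block_mx 1%:M (- 'i%C%:M) 0 1%:M)).
  by rewrite !det_mulmx !det_ublock !det1 !mulr1 !mul1r.
rewrite !mulmx_block !mul0mx !mul1mx !mulmx0 !mulmx1 !add0r !addr0.
rewrite !mul_scalar_mx -BE !mulmxN !mul_mx_scalar.
have -> : - ('i%C *: B) + (- Y + 'i%C *: X) = 0.
  have ii : 'i%C * 'i%C = -1 :> C by rewrite -expr2 sqr_i.
  by rewrite BE scalerDr scalerA ii scaleN1r opprB addrACA subrr addNr addr0.
by rewrite det_lblock BJ addrC.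
Qed.

End realification.

(** * Hermitian positivity and complex Gaussian integrals *)

Section complex_gaussian.
Variable R : realType.
Local Notation C := R[i].
Local Notation Re := (@complex.Re R).
Local Notation Im := (@complex.Im R).

(** In the order of [C], [0 < z] also says that [z] is real. *)
Definition cposdef n (K : 'M[C]_n) :=
  forall x : 'cV[C]_n, x != 0 -> 0 < (hadj x *m K *m x) 0 0.

Lemma hadj_eq0 m n (A : 'M[C]_(m, n)) : (hadj A == 0) = (A == 0).
Proof. by rewrite trmx_eq0 map_mx_eq0. Qed.

Lemma cposdef_unit n (K : 'M[C]_n) : cposdef K -> K \in unitmx.
Proof.
move=> pK; rewrite unitmxE unitfE; apply/negP => /det0P[v v0 vK].
by have := pK (hadj v); rewrite hadjK vK mul0mx mxE ltxx hadj_eq0 => /(_ v0).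
Qed.

Lemma cposdef_drsubmx k (K : 'M[C]_(1 + k)) : cposdef K -> cposdef (drsubmx K).
Proof.
move=> pK x x0; have := pK (col_mx 0 x).
rewrite hadj_col_mx /hadj map_mx0 trmx0 -{1}[K]submxK mul_row_block mul_row_col.
rewrite !mul0mx mulmx0 !add0r; apply.
by rewrite col_mx_eq0 negb_and x0 orbT.
Qed.

Lemma cposdef_schur_gt0 k (K : 'M[C]_(1 + k)) : cposdef K -> 0 < schur K.
Proof.
move=> pK; have := pK _ (schur_vec_neq0 K).
rewrite -mulmxA mul_schur_vec ?cposdef_unit//; last exact: cposdef_drsubmx.
by rewrite hadj_col_mx hadj1 mul_row_col mulmx0 addr0 mul1mx mxE mulr1n.
Qed.

Lemma cposdef_det_gt0 n (K : 'M[C]_n) : cposdef K -> 0 < \det K.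
Proof.
elim: n K => [|k IH] K pK; first by rewrite det_mx00.
pose K1 : 'M[C]_(1 + k) := K.
rewrite -[K]/K1 det_schur ?cposdef_unit//; last exact: cposdef_drsubmx.
by rewrite mulr_gt0 ?cposdef_schur_gt0// IH//; exact: cposdef_drsubmx.
Qed.

Lemma gtc0_Re (x : C) : 0 < x -> 0 < Re x.
Proof. by rewrite ltcE => /andP[]. Qed.

Lemma gtc0_Im (x : C) : 0 < x -> Im x = 0.
Proof. by rewrite ltcE => /andP[/eqP->]. Qed.

(** Every real vector of length [n + n] is [realcol z] for some [z], and [Re_qform] transfers
    positivity. *)
Lemma posdef_realmx n (K : 'M[C]_n) : cposdef K -> posdef (realmx K).
Proof.
move=> pK x x0.
pose z : 'cV[C]_n := \col_i Complex (usubmx x i 0) (dsubmx x i 0).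
have xE : realcol z = x.
  rewrite -[RHS]vsubmxK; congr col_mx; apply/matrixP => i j;
  by rewrite !mxE ord1.
have z0 : z != 0.
  apply: contraNneq x0 => z0; rewrite -xE z0; apply/eqP/matrixP => i j.
  by rewrite !mxE; case: splitP => k _; rewrite !mxE.
by rewrite -xE -Re_qform; apply: gtc0_Re; exact: pK.
Qed.

(** Matches the variable order of [intC], real parts before imaginary parts, with the blocks of
    [realcol]. *)
Lemma realcol_vcol n (v : nat -> R) :
  realcol (\col_(i < n) Complex (v i) (v (n + i)%N)) = vcol (n + n) v.
Proof.
by apply/matrixP => i j; rewrite !mxE; case: splitP => k ->; rewrite !mxE.
Qed.

Lemma intC_gauss n (K : 'M[C]_n) (l : 'rV[C]_n) (c : R) :
  hadj K = K -> cposdef K ->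
  intC (fun x => expR (- Re ((hadj x *m K *m x) 0 0) + 2 * Re ((l *m x) 0 0) + c)) =
  pi ^+ n / Re (\det K) * expR (Re ((l *m invmx K *m hadj l) 0 0) + c).
Proof.
move=> hK pK; rewrite /intC.
rewrite (@eq_intRk _ _ _ (fun v => expR (- ((vcol (n + n) v)^T *m realmx K *m vcol (n + n) v) 0 0 +
   2 * (realrow l *m vcol (n + n) v) 0 0 + c))); last first.
  by move=> v; rewrite Re_qform Re_lform realcol_vcol.
rewrite (@intRk_gauss _ _ _ _ (realrow (l *m invmx K))); last 3 first.
- by rewrite tr_realmx hK.
- exact: posdef_realmx.
- by rewrite -realrowM mulmxKV// cposdef_unit.
rewrite tr_realrow -Re_lform; congr (_ * _).
have dK := cposdef_det_gt0 pK.
(* The determinant of [K] is positive, hence real, so its squared modulus is this square and the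
   root in [intRk_gauss] disappears. *)
have -> : \det (realmx K) = Re (\det K) ^+ 2.
  have := det_realmx K; move: (gtc0_Im dK); case: (\det K) => a b /= ->.
  by move/(congr1 Re) => /= ->; ring.
rewrite exprD -expr2 -expr_div_n sqrtr_sqr ger0_norm// divr_ge0 ?exprn_ge0 ?pi_ge0//.
exact/ltW/gtc0_Re.
Qed.

Lemma cgauss_pdf_prod n (s : R) (v : nat -> R) :
  cgauss_pdf s (\col_(i < n) Complex (v i) (v (n + i)%N)) =
  (pi * s) ^- n * \prod_(i < n + n) gker s (v i).
Proof.
rewrite /cgauss_pdf; congr (_ * _); rewrite /gker -expR_sum; congr expR.
rewrite -mulr_suml sumrN; congr (- _ / _).
rewrite /sqnorm Re_lform -tr_realcol realcol_vcol !mxE.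
by apply: eq_bigr => i _; rewrite !mxE expr2.
Qed.

(** The variance [s / 2] of each real coordinate meets the doubled trace of [realmx B]; the linear
    term has mean zero. *)
Lemma intC_cgauss n (s c : R) (l : 'rV[C]_n) (B : 'M[C]_n) : 0 < s ->
  intC (fun z => cgauss_pdf s z *
    (c + Re ((l *m z) 0 0) + Re ((hadj z *m B *m z) 0 0))) =
  c + s * Re (\tr B).
Proof.
move=> s0; rewrite /intC; pose w := (pi * s) ^- n.
have ps : 0 < pi * s by rewrite mulr_gt0// pi_gt0.
rewrite (@eq_intRk _ _ _ (fun v => (\prod_(i < n + n) gker s (v i)) *
   (w * c + ((w *: realrow l) *m vcol (n + n) v) 0 0 +
    ((vcol (n + n) v)^T *m (w *: realmx B) *m vcol (n + n) v) 0 0))); last first.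
  move=> v; rewrite cgauss_pdf_prod Re_qform Re_lform realcol_vcol -/w.
  by rewrite -scalemxAr -!scalemxAl !scalemxE; ring.
rewrite intRk_poly_gker// linearZ/= mxtrace_realmx exprD -expr2 -exprM mulnC exprM.
rewrite sqr_sqrtr ?ltW// /w; field.
by rewrite expf_neq0 ?gt_eqF.
Qed.

End complex_gaussian.

(** * Expectations of quadratic forms, and regularised Gram matrices *)

Section rate.
Variable R : realType.
Local Notation C := R[i].
Local Notation Re := (@complex.Re R).

Lemma Re_hadj_mul n (u v : 'cV[C]_n) :
  Re ((hadj u *m v) 0 0) = Re ((hadj v *m u) 0 0).
Proof. by rewrite -[in RHS](hadjK u) -hadjM [in RHS]trmxE [in RHS]mxE ReJ. Qed.

(** The noise is averaged first: terms linear in [z] vanish, the form of [M] in [z] gives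
    [N0 * Re (\tr M)], and the rest is a form in [x] with [y] replaced by [H *m x]. *)
Lemma Exy_quad nr nt (H A : 'M[C]_(nr, nt)) (B : 'M[C]_nt) (M : 'M[C]_nr) (Es N0 c : R) :
  0 < Es -> 0 < N0 ->
  Exy H Es N0 (fun x y => c + Re ((hadj y *m A *m x) 0 0) +
    Re ((hadj x *m B *m x) 0 0) + Re ((hadj y *m M *m y) 0 0)) =
  c + Es * Re (\tr (hadj H *m A + B + hadj H *m M *m H)) + N0 * Re (\tr M).
Proof.
move=> Es0 N00; rewrite /Exy.
transitivity (intC (fun x : 'cV[C]_nt => cgauss_pdf Es x *
  (c + N0 * Re (\tr M) + Re (((0 : 'rV_nt) *m x) 0 0) +
   Re ((hadj x *m (hadj H *m A + B + hadj H *m M *m H) *m x) 0 0)))); last first.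
  by rewrite intC_cgauss//; ring.
congr intC; apply/funext => x; set w := cgauss_pdf Es x.
pose c' := w * (c + Re ((hadj x *m (hadj H *m A + B + hadj H *m M *m H) *m x) 0 0)).
(* Terms in [hadj z] become linear in [z] after conjugation, which keeps real parts; the summands
   come from [A] and the two cross terms of [M]. *)
pose l := hadj (A *m x) + hadj (M *m H *m x) + hadj (H *m x) *m M.
transitivity (intC (fun z : 'cV[C]_nr => cgauss_pdf N0 z *
  (c' + Re (((w%:C%C *: l) *m z) 0 0) + Re ((hadj z *m (w%:C%C *: M) *m z) 0 0)))).
  congr intC; apply/funext => z.
  rewrite [w * _]mulrC -[LHS]mulrA; congr (_ * _).
  rewrite -scalemxAr -!scalemxAl !scalemxE !ReZ /c' -!mulrDr; congr (_ * _).
  rewrite /l !mulmxDl hadjD !(mulmxDl, mulmxDr) (hadjM H x) !addmxE !ReD.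
  rewrite !(Re_hadj_mul _ z) !mulmxA.
  by do 7 move: (complex.Re _) => ?; ring.
by rewrite intC_cgauss// mul0mx mxE linearZ/= ReZ /c'; ring.
Qed.

Lemma hadj_sqr_ge0 n (x : 'cV[C]_n) : 0 <= (hadj x *m x) 0 0.
Proof. by rewrite mxE sumr_ge0// => i _; rewrite !mxE mulrC mulcJ_ge0. Qed.

Lemma hadj_sqr_gt0 n (x : 'cV[C]_n) : x != 0 -> 0 < (hadj x *m x) 0 0.
Proof.
move=> x0; rewrite lt_def hadj_sqr_ge0 andbT; apply: contraNneq x0 => xx.
apply/eqP/matrixP => i j; rewrite ord1 [RHS]mxE.
move: xx; rewrite mxE => /eqP; rewrite psumr_eq0; last first.
  by move=> k _; rewrite !mxE mulrC mulcJ_ge0.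
move=> /allP/(_ i (mem_index_enum _)); rewrite !mxE mulf_eq0 conjc_eq0 orbb.
by move=> /eqP.
Qed.

(** Common shape of the matrices to be inverted: the precision [K] of the marginal integral, [T],
    and [T'] obtained from [hadj P]. *)
Definition ridge m n (a b : R) (P : 'M[C]_(m, n)) : 'M[C]_n :=
  a%:C%C%:M + b%:C%C *: (hadj P *m P).

Lemma hadj_ridge m n (a b : R) (P : 'M[C]_(m, n)) : hadj (ridge a b P) = ridge a b P.
Proof.
rewrite hadjD hadjZ hadjM hadjK; congr (_ + _).
by rewrite -scalemx1 hadjZ hadj1.
Qed.

Lemma cposdef_ridge m n (a b : R) (P : 'M[C]_(m, n)) :
  0 < a -> 0 <= b -> cposdef (ridge a b P).
Proof.
move=> a0 b0 x x0; rewrite mulmxDr mulmxDl addmxE mul_mx_scalar.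
rewrite -scalemxAr -!scalemxAl !scalemxE !mulmxA -hadjM -mulmxA.
by rewrite ltr_wpDr ?mulr_ge0 ?hadj_sqr_ge0 ?lecR ?mulr_gt0 ?hadj_sqr_gt0 ?ltcR.
Qed.

Lemma ridge_unit m n (a b : R) (P : 'M[C]_(m, n)) : 0 < a -> 0 <= b ->
  ridge a b P \in unitmx.
Proof. by move=> a0 b0; apply/cposdef_unit/cposdef_ridge. Qed.

Lemma scale_ridge m n (c a b : R) (P : 'M[C]_(m, n)) :
  c%:C%C *: ridge a b P = ridge (c * a) (c * b) P.
Proof. by rewrite /ridge scalerDr scale_scalar_mx scalerA -!rmorphM. Qed.

Lemma lnV_expR (d q : R) : 0 < d -> ln (d^-1 * expR q) = - ln d + q.
Proof.
by move=> d0; rewrite lnM ?posrE ?invr_gt0 ?expR_gt0// lnV ?posrE// expRK.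
Qed.

End rate.

(** * The mismatched marginal in closed form *)

Section wld.
Variables (R : realType) (nr nu m : nat).
Variables (Q : 'M[R[i]]_(nr, nu + m)) (L : 'M[R[i]]_(nu + m)) (Es N0 : R).
Hypotheses (Es0 : 0 < Es) (N00 : 0 < N0).
Local Notation Re := (@complex.Re R).
Local Notation F := (Fp Q L N0).
Local Notation G := (Gp L N0).
Local Notation K := (ridge Es^-1 N0^-1 (Lp L)).
Local Notation T := (ridge 1 (Es / N0) (Lp L)).

(** The prior adds [Es^-1] times the identity to [G], giving [K]; its normalising constant turns
    [\det K] into [\det T]. *)
Lemma pp_margE y : pp_marg Q L N0 Es y =
  (Re (\det T))^-1 * expR (Re ((hadj y *m (F *m invmx K *m hadj F) *m y) 0 0)).
Proof.
pose c := ln ((pi * Es) ^- (nu + m)).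
have pE : 0 < pi * Es by rewrite mulr_gt0 ?pi_gt0.
have cE : expR c = (pi * Es) ^- (nu + m) by rewrite lnK// posrE invr_gt0 exprn_gt0.
transitivity (intC (fun x : 'cV[R[i]]_(nu + m) =>
   expR (- Re ((hadj x *m K *m x) 0 0) + 2 * Re (((hadj y *m F) *m x) 0 0) + c))).
  congr intC; apply/funext => x.
  rewrite /pp_cond /cgauss_pdf -cE mulrCA mulrC -!expRD; congr expR.
  rewrite /sqnorm mulmxDr mulmxDl addmxE ReD mul_mx_scalar -scalemxAl scalemxE ReZ.
  by rewrite /Gp; ring.
rewrite intC_gauss; last 2 first.
- exact: hadj_ridge.
- by apply: cposdef_ridge; rewrite ?ltW ?invr_gt0.
rewrite expRD cE hadjM hadjK !mulmxA mulrCA mulrC; congr (_ * _).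
(* Writing [1] as [Es / Es] displays [T] as [Es] times [K]. *)
rewrite -[1](divff (lt0r_neq0 Es0)) -scale_ridge detZ -rmorphXn ReZ exprMn invfM; field.
rewrite !expf_neq0 ?gt_eqF ?pi_gt0//=.
apply: gtc0_Re; apply: cposdef_det_gt0; apply: cposdef_ridge; rewrite ?ltW ?invr_gt0//.
Qed.

End wld.

(** * Trace identities for the rate *)

Section traces.
Variables (R : realType) (nr n : nat).
Variables (Q : 'M[R[i]]_(nr, n)) (L W P : 'M[R[i]]_n) (Es N0 : R).
Hypotheses (Es0 : 0 < Es) (N00 : 0 < N0) (QQ : hadj Q *m Q = 1%:M).
Local Notation Re := (@complex.Re R).
Hypothesis PE : P = W *m L.
Let F := N0^-1%:C%C *: (Q *m hadj W *m P).
Let G := N0^-1%:C%C *: (hadj P *m P).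
Let K := ridge Es^-1 N0^-1 P.
Let M := F *m invmx K *m hadj F.
Let H := Q *m L.
Let T := ridge 1 (Es / N0) P.
Let T' := ridge 1 (Es / N0) (hadj P).
Let N := (Es / N0)%:C%C *: (P *m invmx T *m hadj P).

Lemma beta_ge0 : 0 <= Es / N0. Proof. by rewrite divr_ge0 ?ltW. Qed.

Lemma scaleEsG : Es%:C%C *: G = T - 1%:M.
Proof. by rewrite /G scalerA -rmorphM /T /ridge [X in _ = X - _]addrC; exact/esym/addrK. Qed.

Lemma invmxK_ridge : invmx K = Es%:C%C *: invmx T.
Proof.
have uK : K \in unitmx by rewrite ridge_unit ?invr_ge0 ?invr_gt0 ?ltW.
have uT : T \in unitmx by rewrite ridge_unit ?beta_ge0.
apply: (can_inj (mulKmx uK)); rewrite (mulmxV uK).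
by rewrite -(scalemxAr _ K) (scalemxAl _ K) scale_ridge divff ?gt_eqF// (mulmxV uT).
Qed.

Lemma hadjHF : hadj H *m F = G.
Proof.
rewrite /H /F -scalemxAr !mulmxA hadjM -(mulmxA _ (hadj Q)) QQ mulmx1.
by rewrite -hadjM -PE.
Qed.

Lemma hadjFH : hadj F *m H = G.
Proof. by rewrite -[hadj F *m H]hadjK hadjM hadjK hadjHF hadjZ hadjM hadjK. Qed.

(** Since [T' *m P = P *m T], multiplying [N] by [T'] cancels [invmx T] and leaves [T' - 1%:M]. *)
Lemma trace_pushthrough : N = 1%:M - invmx T'.
Proof.
have uT : T \in unitmx by rewrite ridge_unit ?beta_ge0.
have uT' : T' \in unitmx by rewrite ridge_unit ?beta_ge0.
have TP : T' *m P = P *m T.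
  rewrite /T /T' /ridge hadjK mulmxDl mulmxDr mul_scalar_mx mul_mx_scalar.
  by rewrite -scalemxAl -scalemxAr mulmxA.
apply: (can_inj (mulKmx uT')); rewrite mulmxBr mulmxV// mulmx1.
rewrite /N -(scalemxAr _ T') !(mulmxA T') TP (mulmxK uT).
by rewrite /T' /ridge hadjK [X in _ = X - _]addrC; exact/esym/addrK.
Qed.

(** From [Es *: G = T - 1] and [invmx K = Es *: invmx T], the difference is [invmx T *m G];
    cyclicity of the trace does the rest. *)
Lemma trace_signal :
  \tr (Es%:C%C *: (G - G *m invmx K *m G)) = \tr N.
Proof.
have uT : T \in unitmx by rewrite ridge_unit ?beta_ge0.
have -> : G *m invmx K = 1%:M - invmx T.
  rewrite invmxK_ridge -(scalemxAr _ G) (scalemxAl _ G) scaleEsG mulmxBl.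
  by rewrite (mulmxV uT) mul1mx.
rewrite mulmxBl mul1mx opprB addrC subrK (scalemxAr _ (invmx T)).
have -> : Es%:C%C *: G = (Es / N0)%:C%C *: (hadj P *m P).
  by rewrite /G scalerA -rmorphM.
transitivity ((Es / N0)%:C%C * \tr (invmx T *m (hadj P *m P))).
  by rewrite -(scalemxAr _ (invmx T)); exact: mxtraceZ.
rewrite /N mxtraceZ; congr (_ * _).
by rewrite -(mulmxA P) (mxtrace_mulC P) -mulmxA.
Qed.

(** Cyclicity brings the two copies of [Q] together, where they cancel by [QQ]; the scalars combine
    to [Es / N0]. *)
Lemma trace_noise : \tr (N0%:C%C *: M) = \tr (W *m hadj W *m N).
Proof.
rewrite linearZ/= /M -mulmxA mxtrace_mulC invmxK_ridge /F hadjZ.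
rewrite !hadjM hadjK -!scalemxAl -!scalemxAr -!scalemxAl !linearZ/= !mulrA.
rewrite -!rmorphM/=; congr (_%:C%C * _); first by field; rewrite gt_eqF.
have QW : hadj P *m (W *m hadj Q) *m (Q *m hadj W *m P) =
          hadj P *m (W *m hadj W *m P).
  by rewrite !mulmxA -(mulmxA _ (hadj Q)) QQ mulmx1.
rewrite -(mulmxA (invmx T)) QW (mulmxA (invmx T)) mxtrace_mulC.
by rewrite -(mulmxA (W *m _)) (mulmxA P).
Qed.

(** The left side is the trace of [(1 - W W^+) N] with [N = 1 - invmx T']; the hypothesis says that
    [1 - W W^+] has trace of real part zero, so only the [invmx T'] term remains. *)
Lemma trace_rate : Re (\tr (W *m hadj W)) = n%:R ->
  Es * Re (\tr (hadj H *m (2%:C%C *: F) - G)) -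
  (Es * Re (\tr (hadj H *m M *m H)) + N0 * Re (\tr M)) =
  - Re (\tr ((1%:M - W *m hadj W) *m invmx T')).
Proof.
move=> trW.
have -> : hadj H *m (2%:C%C *: F) - G = G.
  by rewrite -scalemxAr hadjHF rmorph_nat -mulr_natl mulr_natl scaler_nat mulr2n addrK.
have -> : hadj H *m M *m H = G *m invmx K *m G.
  by rewrite /M !(mulmxA (hadj H)) hadjHF -(mulmxA _ (hadj F)) hadjFH.
have signal : Es * Re (\tr G) - Es * Re (\tr (G *m invmx K *m G)) = Re (\tr N).
  by rewrite -trace_signal mxtraceZ ReZ raddfB/= ReD ReN mulrBr.
have noise : N0 * Re (\tr M) = Re (\tr (W *m hadj W *m N)).
  by rewrite -trace_noise mxtraceZ ReZ.
have Re_nat : Re n%:R = n%:R by rewrite -[n%:R in LHS](rmorph_nat (real_complex R)).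
rewrite opprD addrA signal noise trace_pushthrough mulmxBr mulmx1 mulmxBl mul1mx.
by rewrite !raddfB/= trW mxtrace1 Re_nat; ring.
Qed.

End traces.

(** * The row normalisation in the puncturing matrix *)

Section whitening.
Variables (R : realType) (nu m : nat) (L : 'M[R[i]]_(nu + m)).
Local Notation Re := (@complex.Re R).

Lemma Sblk_unit : (forall i j : 'I_(nu + m), (i < j)%N -> L i j = 0) ->
  (forall i, 0 < L i i) -> Sblk L \in unitmx.
Proof.
move=> trL dL; rewrite unitmxE det_trig; last first.
  by apply/is_trig_mxP => i j ij; rewrite !mxE trL//= ltn_add2l.
rewrite unitfE; apply/prodf_neq0 => i _; rewrite !mxE gt_eqF//; exact: dL.
Qed.

(** The entry is the squared norm of row [i], which is nonzero as [A] is invertible. *)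
Lemma mul_hadj_diag_gt0 n (A : 'M[R[i]]_n) i : A \in unitmx ->
  0 < Re ((A *m hadj A) i i).
Proof.
move=> uA; have ri : hadj (row i A) != 0.
  rewrite hadj_eq0 rowE; apply/eqP => /(congr1 (mulmx^~ (invmx A))).
  rewrite mulmxK// mul0mx => /matrixP/(_ 0 i); rewrite !mxE !eqxx => /eqP.
  by rewrite oner_eq0.
have := gtc0_Re (hadj_sqr_gt0 ri); rewrite hadjK.
have -> : row i A *m hadj (row i A) = ((A *m hadj A) i i)%:M.
  apply/matrixP => a b; rewrite !ord1 !mxE mulr1n.
  by apply: eq_bigr => k _; rewrite !mxE.
by rewrite mxE mulr1n.
Qed.

Lemma Re_diag_normalize n (B : 'M[R[i]]_n) i : 0 < Re (B i i) ->
  let D := diag_mx (\row_j ((Num.sqrt (Re (B j j)))^-1)%:C%C) in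
  Re ((D *m B *m D) i i) = 1.
Proof.
move=> B0 D; rewrite /D mul_mx_diag mul_diag_mx !mxE mulrAC -rmorphM ReZ.
by rewrite -expr2 exprVn sqr_sqrtr ?ltW// mulVf ?gt_eqF.
Qed.

(** The identity block contributes [nu]; [Sigma] scales each of the [m] rows of [Sinv] to unit
    norm. *)
Lemma mxtrace_Wp : Sblk L \in unitmx ->
  Re (\tr (Wp L *m hadj (Wp L))) = (nu + m)%:R.
Proof.
move=> uS.
have uI : Sinv L \in unitmx by rewrite unitmx_inv.
have -> : hadj (Wp L) = block_mx 1%:M 0 0 (hadj (Sigma L *m Sinv L)).
  by rewrite /Wp /hadj map_block_mx tr_block_mx !map_mx0 !trmx0 map_mx1 trmx1.
rewrite /Wp mulmx_block !mul0mx !mulmx0 mul1mx addr0 add0r mxtrace_block ReD mxtrace1.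
rewrite natrD; congr (_ + _).
  by rewrite -[nu%:R in LHS](rmorph_nat (real_complex R)).
rewrite /mxtrace Re_sum -[m in RHS]card_ord -sumr_const; apply: eq_bigr => i _.
have a0 := mul_hadj_diag_gt0 i uI.
rewrite hadjM mulmxA -(mulmxA (Sigma L)).
have -> : hadj (Sigma L) = Sigma L.
  rewrite /hadj map_diag_mx tr_diag_mx; congr diag_mx.
  by apply/matrixP => k j; rewrite !mxE; exact: conjc_real.
by rewrite add0r; exact: (Re_diag_normalize a0).
Qed.

End whitening.

(* N_t = nu + m, puncturing order nu with 1 <= nu <= N_t - 1, i.e. 1 <= m *)
Theorem theorem1 (R : realType) (nr nu m : nat)
  (hnu : (0 < nu)%N) (hm : (0 < m)%N) (hr : (nu + m <= nr)%N)
  (H Q : 'M[R[i]]_(nr, nu + m)) (L : 'M[R[i]]_(nu + m))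
  (Es N0 : R) (hEs : 0 < Es) (hN0 : 0 < N0)
  (hrank : \rank H = (nu + m)%N)
  (hQL : thin_QL H Q L) :
  let beta := Es / N0 in
  let Lp_ := Lp L in
  let Wp_ := Wp L in
  I_LB_WLD H Q L Es N0 =
    ln (complex.Re (\det (1%:M + beta%:C%C *: (hadj Lp_ *m Lp_))))
    - complex.Re (\tr ((1%:M - Wp_ *m hadj Wp_)
                        *m invmx (1%:M + beta%:C%C *: (Lp_ *m hadj Lp_)))).
Proof.
case: hQL => QQ trL dL HE beta Lp_ Wp_.
have b0 : 0 <= beta by rewrite divr_ge0 ?ltW.
have -> : 1%:M + beta%:C%C *: (hadj Lp_ *m Lp_) = ridge 1 beta Lp_ by [].
have -> : 1%:M + beta%:C%C *: (Lp_ *m hadj Lp_) = ridge 1 beta (hadj Lp_).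
  by rewrite /ridge hadjK.
have d0 : 0 < complex.Re (\det (ridge 1 beta Lp_)).
  by apply/gtc0_Re/cposdef_det_gt0/cposdef_ridge.
pose F := Fp Q L N0; pose K := ridge Es^-1 N0^-1 Lp_.
pose M := F *m invmx K *m hadj F.
have zero11 : (0 : 'M[R[i]]_1) 0 0 = 0 by rewrite mxE.
(* The log-likelihood is the polynomial of [Exy_quad] with coefficients [2 F], [- Gp] and no form in
   [y]. *)
have signal : Exy H Es N0 (fun x y => ln (pp_cond Q L N0 y x)) =
    Es * complex.Re (\tr (hadj H *m (2%:C%C *: F) - Gp L N0)).
  transitivity (Exy H Es N0 (fun x y => 0 +
      complex.Re ((hadj y *m (2%:C%C *: F) *m x) 0 0) +
      complex.Re ((hadj x *m (- Gp L N0) *m x) 0 0) +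
      complex.Re ((hadj y *m (0 : 'M[R[i]]_nr) *m y) 0 0))).
    congr (Exy _ _ _ _); apply/funext => x; apply/funext => y.
    have -> : hadj y *m (2%:C%C *: F) *m x = 2%:C%C *: (hadj y *m F *m x).
      by rewrite -scalemxAr -scalemxAl.
    rewrite /pp_cond expRK mulmx0 mul0mx mulmxN mulNmx oppmxE ReN zero11 add0r addr0.
    by rewrite scalemxE ReZ.
  rewrite Exy_quad// mulmx0 mul0mx addr0 mxtrace0 add0r.
  by rewrite [X in _ + N0 * X](_ : _ = 0)// mulr0 addr0.
(* By [pp_margE] the log-marginal is a constant plus a form in [y] alone; that constant is minus the
   log-determinant of the rate. *)
have noise : Exy H Es N0 (fun x y => ln (pp_marg Q L N0 Es y)) =
    - ln (complex.Re (\det (ridge 1 beta Lp_))) +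
    (Es * complex.Re (\tr (hadj H *m M *m H)) + N0 * complex.Re (\tr M)).
  transitivity (Exy H Es N0 (fun x y => - ln (complex.Re (\det (ridge 1 beta Lp_))) +
      complex.Re ((hadj y *m (0 : 'M[R[i]]_(nr, nu + m)) *m x) 0 0) +
      complex.Re ((hadj x *m (0 : 'M[R[i]]_(nu + m)) *m x) 0 0) +
      complex.Re ((hadj y *m M *m y) 0 0))).
    congr (Exy _ _ _ _); apply/funext => x; apply/funext => y.
    by rewrite pp_margE// lnV_expR// !mulmx0 !mul0mx !zero11 !addr0.
  by rewrite Exy_quad// mulmx0 !add0r -addrA.
rewrite /I_LB_WLD signal noise opprD opprK addrCA; congr (_ + _).
rewrite HE; apply: (@trace_rate _ _ _ Q L Wp_ Lp_) => //.
by apply: mxtrace_Wp; exact: Sblk_unit.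
Qed.
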